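(* Let $\sigma=\sigma^\infty$, with $\sigma^\infty$ the asymptotic restriction defined in the context. Assume that the restricted problem $\mathrm{LP}(\sigma^\infty)$ is feasible and that its optimal solution is unique. Let $(y_1^\star,\ldots,y_N^\star)$ be an optimal solution of the master problem $\mathrm{Master}(\sigma^\infty)$. Then the vector $(x_1^\infty,\ldots,x_N^\infty)$, with each $x_i^\infty$ an optimal solution of the lexicographic problem $\mathrm{Lex}_i(y_i^\star)$, is feasible for the target MILP, i.e., $x_i^\infty\in X_i$ for all $i\in\{1,\ldots,N\}$ and $\sum_{i=1}^N A_ix_i^\infty\le b$.
   Context: Setting. There are $N$ agents and $S$ linear coupling constraints (the regime of interest is $N\gg S$; no quantitative relation is imposed). For each $i\in\{1,\ldots,N\}$: $X_i=P_i\cap(\mathbb{Z}^{p_i}\times\mathbb{R}^{q_i})$ with $P_i\subset\mathbb{R}^{p_i+q_i}$ a nonempty compact polyhedron, $c_i\in\mathbb{R}^{p_i+q_i}$, $A_i\in\mathbb{R}^{S\times(p_i+q_i)}$; and $b\in\mathbb{R}^S$. The target MILP is: minimize $\sum_{i=1}^N c_i^\top x_i$ subject to $\sum_{i=1}^N A_ix_i\le b$ and $x_i\in X_i$ for all $i$; it is assumed feasible. Vector inequalities are componentwise, $\max$ and $\min$ of vectors are componentwise, $[\cdot]_s$ is the $s$-th component, $\mathbf{1}$ is the vector of ones, and $\mathrm{conv}(X_i)$ is the convex hull of $X_i$. Restricted problem $\mathrm{LP}(\sigma)$, for $\sigma\in\mathbb{R}^S$, $\sigma\ge0$: minimize $\sum_{i=1}^N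 c_i^\top z_i$ over $z_1,\dots,z_N$ subject to $\sum_{i=1}^N A_iz_i\le b-\sigma$ and $z_i\in\mathrm{conv}(X_i)$ for all $i$. Master problem $\mathrm{Master}(\sigma)$: minimize $\sum_{i=1}^N \pi_i(y_i)$ over $y_1,\dots,y_N\in\mathbb{R}^S$ subject to $\sum_{i=1}^N y_i=b-\sigma$ and $y_i\in Y_i$ for all $i$, where $\pi_i(y_i)=\min\{c_i^\top z_i : A_iz_i\le y_i,\ z_i\in\mathrm{conv}(X_i)\}$ and $Y_i$ is the set of $y_i\in\mathbb{R}^S$ for which this minimization is feasible. Lexicographic problem $\mathrm{Lex}_i(y_i)$: minimize lexicographically $\rho_i$, then $\xi_i$, over $(\rho_i,\xi_i,x_i)$ subject to $c_i^\top x_i\le\xi_i$, $A_ix_i\le y_i+\rho_i\mathbf{1}$, $x_i\in X_i$, $\rho_i\ge0$. Equivalently: first let $\bar\rho_i$ be the minimum of $\rho_i\ge 0$ such that some $x_i\in X_i$ satisfies $A_ix_i\le y_i+\rho_i\mathbf{1}$; then $x_i$ is a minimizer of $c_i^\top x_i$ over $x_i\in X_i$ with $A_ix_i\le y_i+\bar\rho_i\mathbf{1}$. Asymptotic restriction: let $L_i=\min_{x_i\in X_i}A_ix_i\in\mathbb{R}^S$ (componentwise), $\rho_i^{\max}=\min_{x_i\in X_i}\max_{s\in\{1,\ldots,S\}}[A_ix_i-L_i]_s$, $\sigma_i^{\mathrm{loc}}=\min\{\rho_i^{\max}\mathbf{1},\ \max_{x_i\in X_i}(A_ix_i-L_i)\}\in\mathbb{R}^S$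 (componentwise), and $\sigma^\infty=S\cdot\max_{i\in\{1,\ldots,N\}}\sigma_i^{\mathrm{loc}}\in\mathbb{R}^S$ (componentwise). *)

(* Defs.v *)
From HB Require Import structures.
From mathcomp Require Import all_boot all_order all_algebra.
From mathcomp Require Import all_classical all_reals all_analysis.
Import Order.TTheory GRing.Theory Num.Theory.
Import numFieldNormedType.Exports.

Set Implicit Arguments.
Unset Strict Implicit.
Unset Printing Implicit Defensive.

Local Open Scope classical_set_scope.
Local Open Scope ring_scope.

Definition vle (R : realType) (m : nat) (u v : 'cV[R]_m) : Prop :=
  forall s, u s 0 <= v s 0.

Definition dotv (R : realType) (n : nat) (c x : 'cV[R]_n) : R :=
  (c^T *m x) 0 0.

Definition polyhedron (R : realType) (n : nat) (P : set 'cV[R]_n) : Prop :=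
  exists (m : nat) (D : 'M[R]_(m, n)) (d : 'cV[R]_m),
    P = [set x | vle (D *m x) d].

(* P `&` (Z^p x R^q): the first p coordinates are integers. *)
Definition mixed_integer (R : realType) (p q : nat) (P : set 'cV[R]_(p + q)) :
    set 'cV[R]_(p + q) :=
  [set x | P x /\ forall j : 'I_p, x (lshift q j) 0 \is a Num.int].

Definition conv_hull (R : realType) (n : nat) (X : set 'cV[R]_n) :
    set 'cV[R]_n :=
  [set z | exists (k : nat) (w : 'I_k -> R) (v : 'I_k -> 'cV[R]_n),
     [/\ forall j, 0 <= w j,
         \sum_(j < k) w j = 1,
         forall j, X (v j) &
         z = \sum_(j < k) w j *: v j]].

(* The minima and maxima of the problem are written with inf and sup: every
   set concerned is nonempty and is either finite or the image of a compact set
   under a continuous map, so that the bounds are attained. *)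

Section Agent.
Variables (R : realType) (S n : nat).
Variables (X : set 'cV[R]_n) (c : 'cV[R]_n) (A : 'M[R]_(S, n)).

Definition pi_feasible (y : 'cV[R]_S) : set 'cV[R]_n :=
  [set z | conv_hull X z /\ vle (A *m z) y].

Definition Ydom : set 'cV[R]_S := [set y | pi_feasible y !=set0].

(* Only meaningful for y in Ydom. *)
Definition pi_val (y : 'cV[R]_S) : R :=
  inf [set dotv c z | z in pi_feasible y].

Definition lex_feasible (y : 'cV[R]_S) (rho xi : R) (x : 'cV[R]_n) : Prop :=
  [/\ dotv c x <= xi, vle (A *m x) (y + const_mx rho), X x & 0 <= rho].

Definition lex_optimal (y : 'cV[R]_S) (rho xi : R) (x : 'cV[R]_n) : Prop :=
  lex_feasible y rho xi x /\
  forall rho' xi' x', lex_feasible y rho' xi' x' ->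
    rho < rho' \/ (rho = rho' /\ xi <= xi').

Definition Lmin : 'cV[R]_S := \col_s inf [set (A *m x) s 0 | x in X].

Definition rho_max : R :=
  inf [set sup (range (fun s => (A *m x - Lmin) s 0)) | x in X].

Definition sigma_loc : 'cV[R]_S :=
  \col_s Num.min rho_max (sup [set (A *m x - Lmin) s 0 | x in X]).

End Agent.

Section Problem.
Variables (R : realType) (N S : nat) (n : 'I_N -> nat).
Variables (X : forall i, set 'cV[R]_(n i)) (c : forall i, 'cV[R]_(n i)).
Variables (A : forall i, 'M[R]_(S, n i)) (b : 'cV[R]_S).
Arguments X : clear implicits.

Definition sigma_infty : 'cV[R]_S :=
  \col_s (S%:R * sup (range (fun i => sigma_loc (X i) (A i) s 0))).

Definition MILP_feasible (x : forall i, 'cV[R]_(n i)) : Prop :=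
  (forall i, X i (x i)) /\ vle (\sum_i A i *m x i) b.

Definition LP_feasible (sigma : 'cV[R]_S) (z : forall i, 'cV[R]_(n i)) : Prop :=
  (forall i, conv_hull (X i) (z i)) /\ vle (\sum_i A i *m z i) (b - sigma).

Definition LP_optimal (sigma : 'cV[R]_S) (z : forall i, 'cV[R]_(n i)) : Prop :=
  LP_feasible sigma z /\
  forall z', LP_feasible sigma z' ->
    \sum_i dotv (c i) (z i) <= \sum_i dotv (c i) (z' i).

Definition Master_feasible (sigma : 'cV[R]_S) (y : 'I_N -> 'cV[R]_S) : Prop :=
  (forall i, Ydom (X i) (A i) (y i)) /\ \sum_i y i = b - sigma.

Definition Master_optimal (sigma : 'cV[R]_S) (y : 'I_N -> 'cV[R]_S) : Prop :=
  Master_feasible sigma y /\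
  forall y', Master_feasible sigma y' ->
    \sum_i pi_val (X i) (c i) (A i) (y i) <=
    \sum_i pi_val (X i) (c i) (A i) (y' i).

End Problem.

(* Main.v *)
Require Import Defs.
From HB Require Import structures.
From mathcomp Require Import all_boot all_order all_algebra.
From mathcomp Require Import all_classical all_reals all_analysis.
Import Order.TTheory GRing.Theory Num.Theory.
Import numFieldNormedType.Exports.
From mathcomp Require Import ring lra.

(** Each subproblem of the master problem attains its minimum, because the
    convex hull of a compact set is compact ([compact_conv_hull]).  Minimizers
    for an optimal allocation [y] of the resources therefore form an optimal
    solution of LP(sigma) ([master_optimal_recovers_LP]): an LP solution, with
    its slack handed to some agent, is an allocation of no larger master value.
    By uniqueness it is the optimal solution [z], so [A i *m z i <= y i].

    At most [S] components of [z] lie outside their set [X i]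
    ([unique_LP_optimal_few_outside]).  Such a component is the midpoint of a
    nontrivial segment of the convex hull.  With more than [S] of them, a
    nontrivial combination of the segment directions leaves the [S] coupling
    rows unchanged, so that [z] is the midpoint of a segment of LP solutions.
    Neither end is cheaper and their costs average to that of [z],
    so that both ends are optimal too.

    If [z i] is in [X i], the lexicographic problem reaches [rho = 0] and
    agent [i] respects its share [y i] ([lex_no_violation]).  Any other agent
    exceeds it by at most [sigma_loc] ([lex_violation_le]).  The total excess is
    then at most [S] times the largest [sigma_loc], which is exactly the amount
    by which sigma tightens the coupling constraint. *)

Local Open Scope classical_set_scope.
Local Open Scope ring_scope.

(** * Linear dependence *)

Lemma dependent_family {R : fieldType} {T : finType} {m : nat}
    (I : {pred T}) (u : T -> 'cV[R]_m) :
  (m < #|I|)%N ->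
  exists l : T -> R, [/\ forall i, i \notin I -> l i = 0,
    exists i, l i != 0 & \sum_i l i *: u i = 0].
Proof.
move=> ltmI.
pose B := \matrix_(j < #|I|) (u (enum_val j))^T.
have /rowV0Pn[w /sub_kermxP wB w0] : kermx B != 0.
  rewrite kermx_eq0 -row_leq_rank -ltnNge.
  exact: leq_ltn_trans (rank_leq_col B) ltmI.
have [j wj] : exists j, w 0 j != 0.
  apply/existsP; apply: contraNT w0 => /existsPn H.
  by apply/eqP/rowP => j; rewrite mxE; apply/eqP; have := H j; rewrite negbK.
have i0I := enum_valP j; set i0 := enum_val j in i0I.
pose r := enum_rank_in i0I.
exists (fun i => if i \in I then w 0 (r i) else 0); split.
- by move=> i /negPf ->.
- by exists i0; rewrite i0I /r /i0 enum_valK_in.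
- rewrite (eq_bigr (fun i => if i \in I then w 0 (r i) *: u i else 0)); last first.
    by move=> i _; case: ifP => // _; rewrite scale0r.
  rewrite -big_mkcond big_enum_val /=; apply: trmx_inj.
  rewrite trmx0 -wB mulmx_sum_row linear_sum; apply: eq_bigr => k _.
  by rewrite linearZ /r enum_valK_in rowK.
Qed.

(** * Convex hulls in finite dimension *)

Section ConvexHull.
Context {R : realType} {n : nat}.
Implicit Types (X : set 'cV[R]_n) (z d : 'cV[R]_n).

(** Iterating this operation from [X] builds convex hulls out of binary products
    and continuous images, both of which preserve compactness. *)
Definition segment_join X (Z : set 'cV[R]_n) : set 'cV[R]_n :=
  [set (1 - t.1.1) *: t.1.2 + t.1.1 *: t.2 | t in (`[0, 1] `*` Z) `*` X].

Lemma conv_hull_sub X z : X z -> conv_hull X z.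
Proof.
move=> Xz; exists 1%N, (fun=> 1), (fun=> z); split => //.
- by rewrite big_ord1.
- by rewrite big_ord1 scale1r.
Qed.

Lemma conv_hull_convex X z1 z2 (t : R) : 0 <= t <= 1 ->
  conv_hull X z1 -> conv_hull X z2 -> conv_hull X ((1 - t) *: z1 + t *: z2).
Proof.
move=> /andP[t0 t1] [k1 [w1 [v1 [p1 s1 x1 ->]]]] [k2 [w2 [v2 [p2 s2 x2 ->]]]].
exists (k1 + k2)%N.
exists (fun j => match fintype.split j with
                 | inl a => (1 - t) * w1 a | inr a => t * w2 a end).
exists (fun j => match fintype.split j with inl a => v1 a | inr a => v2 a end).
have sl a : fintype.split (lshift k2 a) = inl a :> 'I_k1 + 'I_k2
  by exact: (unsplitK (inl a)).
have sr a : fintype.split (rshift k1 a) = inr a :> 'I_k1 + 'I_k2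
  by exact: (unsplitK (inr a)).
split.
- by move=> j; case: fintype.split => a; rewrite mulr_ge0 ?subr_ge0.
- rewrite big_split_ord /=; under eq_bigr do rewrite sl.
  under [X in _ + X]eq_bigr do rewrite sr.
  by rewrite -!mulr_sumr s1 s2 !mulr1 subrK.
- by move=> j; case: fintype.split.
- rewrite big_split_ord /=; under [X in _ = X + _]eq_bigr do rewrite sl.
  under [X in _ = _ + X]eq_bigr do rewrite sr.
  by rewrite !scaler_sumr; congr (_ + _); apply: eq_bigr => j _; rewrite scalerA.
Qed.

Lemma conv_hull_segment X z d (t : R) : `|t| <= 1 ->
  conv_hull X (z + d) -> conv_hull X (z - d) -> conv_hull X (z + t *: d).
Proof.
rewrite ler_norml => /andP[t1 t2] zp zm.
have -> : z + t *: d =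
    (1 - (1 + t) / 2) *: (z - d) + ((1 + t) / 2) *: (z + d).
  by apply/colP => i; rewrite !mxE; field.
by apply: conv_hull_convex => //; lra.
Qed.

(** A weight [w j > 0] in a decomposition of [z] allows a move towards the point
    [v j], and a move backwards as well as long as [w j] does not become
    negative; the direction is nonzero since [X] contains [v j] but not [z]. *)
Lemma conv_hull_direction X z : conv_hull X z -> ~ X z ->
  exists d, [/\ d != 0, conv_hull X (z + d) & conv_hull X (z - d)].
Proof.
move=> Cz Xz; have [k [w [v [w0 w1 Xv zE]]]] := Cz.
have [j wj] : exists j, w j != 0.
  apply/existsP; apply: contraT => /existsPn H.
  have := oner_neq0 R; rewrite -w1 big1 ?eqxx // => j _.
  by apply/eqP; have := H j; rewrite negbK.
have wj1 : w j <= 1.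
  by rewrite -w1 (bigD1 j) //= lerDl sumr_ge0.
exists (w j *: (v j - z)); split.
- rewrite scaler_eq0 (negPf wj) /= subr_eq0; apply/eqP => vz.
  by apply: Xz; rewrite -vz.
- have -> : z + w j *: (v j - z) = (1 - w j) *: z + w j *: v j.
    by rewrite scalerBl scale1r scalerBr addrA addrAC.
  by apply: conv_hull_convex => //; [rewrite w0 wj1|exact: conv_hull_sub].
- (* the weight of [v j] becomes [w j ^+ 2] *)
  exists k, (fun i => (1 + w j) * w i - (if i == j then w j else 0)), v; split.
  + move=> i; case: eqP => [->|_]; last by rewrite subr0 mulr_ge0 ?addr_ge0.
    by rewrite mulrDl mul1r addrC addKr mulr_ge0.
  + by rewrite sumrB -mulr_sumr w1 -big_mkcond big_pred1_eq mulr1 addrK.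
  + by [].
  + under eq_bigr do rewrite scalerBl -scalerA.
    rewrite sumrB -scaler_sumr -zE.
    rewrite (eq_bigr (fun i => if i == j then w j *: v j else 0)); last first.
      by move=> i _; case: eqP => [->//|_]; rewrite scale0r.
    rewrite -big_mkcond big_pred1_eq scalerBr scalerDl scale1r.
    by rewrite opprB addrA.
Qed.

(** The Caratheodory step: more than [n + 1] points are affinely dependent, and
    subtracting the largest multiple of the dependence that keeps the weights
    nonnegative makes one of them vanish. *)
Lemma conv_hull_reduce X k (w : 'I_k.+1 -> R) (v : 'I_k.+1 -> 'cV[R]_n) :
  (n < k)%N -> (forall j, 0 <= w j) -> \sum_j w j = 1 -> (forall j, X (v j)) ->
  exists (w' : 'I_k -> R) (v' : 'I_k -> 'cV[R]_n),
    [/\ forall j, 0 <= w' j, \sum_j w' j = 1, forall j, X (v' j) &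
        \sum_j w j *: v j = \sum_j w' j *: v' j].
Proof.
move=> nk w0 w1 Xv.
(* affine dependence is linear dependence of the points lifted to height 1 *)
have [|l [_ [i li] lE]] :=
    dependent_family [pred i : 'I_k.+1 | true]
      (fun j => col_mx (const_mx 1 : 'cV[R]_1) (v j)).
  by rewrite eq_cardT // size_enum_ord.
have l1 : \sum_j l j = 0.
  have /matrixP/(_ (lshift n ord0) 0) := lE.
  rewrite summxE [RHS]mxE => E; rewrite -[RHS]E; apply: eq_bigr => j _.
  by rewrite mxE col_mxEu mxE mulr1.
have lv : \sum_j l j *: v j = 0.
  apply/colP => r; have /matrixP/(_ (rshift 1 r) 0) := lE.
  rewrite summxE [RHS]mxE => E; rewrite summxE [RHS]mxE -[RHS]E; apply: eq_bigr => j _.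
  by rewrite mxE [RHS]mxE col_mxEd.
have [i0 li0] : exists i0, 0 < l i0.
  apply/existsP; apply: contraT => /existsPn H.
  have : \sum_j - l j == 0 by rewrite sumrN l1 oppr0.
  rewrite psumr_eq0; last by move=> j _; rewrite oppr_ge0 leNgt.
  by move=> /allP/(_ i (mem_index_enum _)); rewrite oppr_eq0 (negPf li).
have [j lj jmin] := Order.TotalTheory.arg_minP (fun j => w j / l j)
  (li0 : (fun i => 0 < l i) i0).
pose w' i := w i - w j / l j * l i.
have w'j : w' j = 0 by rewrite /w' divfK ?subrr // gt_eqF.
have w'0 i' : 0 <= w' i'.
  rewrite /w' subr_ge0; have [p|p] := ltP 0 (l i').
    by rewrite -ler_pdivlMr // jmin.
  by apply: le_trans (w0 i'); rewrite mulr_ge0_le0 // divr_ge0 // ltW.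
exists (fun a => w' (lift j a)), (fun a => v (lift j a)); split => //.
- transitivity (\sum_i w' i); first by rewrite (bigD1_ord j) //= w'j add0r.
  by rewrite sumrB w1 -mulr_sumr l1 mulr0 subr0.
- transitivity (\sum_i w' i *: v i); last first.
    by rewrite (bigD1_ord j) //= w'j scale0r add0r.
  under [RHS]eq_bigr do rewrite scalerBl -scalerA.
  by rewrite sumrB -scaler_sumr lv scaler0 subr0.
Qed.

Lemma iter_join_mono X k z :
  X !=set0 -> iter k (segment_join X) X z -> iter k.+1 (segment_join X) X z.
Proof.
move=> [x Xx] Cz; exists ((0, z), x) => /=.
  by split => //; split => //=; rewrite in_itv /= lexx ler01.
by rewrite subr0 scale1r scale0r addr0.
Qed.

Lemma combination_iter_join X k (w : 'I_k.+1 -> R) (v : 'I_k.+1 -> 'cV[R]_n) :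
  (forall j, 0 <= w j) -> \sum_j w j = 1 -> (forall j, X (v j)) ->
  iter k (segment_join X) X (\sum_j w j *: v j).
Proof.
elim: k w v => [|k IH] w v w0 w1 Xv.
  by move: w1; rewrite !big_ord1 => ->; rewrite scale1r.
have X0 : X !=set0 by exists (v ord0).
pose s := \sum_(j < k.+1) w (lift ord0 j).
have ws : w ord0 = 1 - s by rewrite -w1 big_ord_recl addrK.
have s0 : 0 <= s by rewrite sumr_ge0.
have [sE|sN0] := eqVneq s 0.
  (* all the weight sits on the first point *)
  have wl j : w (lift ord0 j) = 0.
    have /eqP := sE; rewrite psumr_eq0 // => /allP/(_ j (mem_index_enum _)).
    by move/eqP.
  rewrite big_ord_recl ws sE subr0 scale1r big1 ?addr0; last first.
    by move=> j _; rewrite wl scale0r.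
  suff H m : iter m (segment_join X) X (v ord0) by exact: (H k.+1).
  elim: m => [|m IHm]; first exact: Xv.
  exact: iter_join_mono.
have sP : 0 < s by rewrite lt_neqAle eq_sym sN0.
have H := IH (fun j => w (lift ord0 j) / s) (fun j => v (lift ord0 j)).
exists ((w ord0, \sum_j (w (lift ord0 j) / s) *: v (lift ord0 j)), v ord0) => /=.
  split => //; split => /=.
    by rewrite in_itv /= w0 ws lerBlDr lerDl.
  apply: H => // [j|]; first by rewrite divr_ge0.
  by rewrite -mulr_suml divff.
rewrite [RHS]big_ord_recl [RHS]addrC; congr (_ + _).
rewrite ws subKr scaler_sumr; apply: eq_bigr => j _.
by rewrite scalerA mulrC divfK.
Qed.

(** By the Caratheodory step, [n] joins suffice: the number of iterations
    does not depend on the point of the hull. *)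
Lemma conv_hull_iter_join X : conv_hull X = iter n (segment_join X) X.
Proof.
apply/seteqP; split => [z [k [w [v [w0 w1 Xv ->]]]]|].
  elim: k w v w0 w1 Xv => [|k IH] w v w0 w1 Xv.
    by move: w1; rewrite big_ord0 => /esym/eqP; rewrite oner_eq0.
  have [kn|nk] := leqP k n.
    have X0 : X !=set0 by exists (v ord0).
    suff H m : iter (m + k) (segment_join X) X (\sum_j w j *: v j).
      by move: (H (n - k)%N); rewrite subnK.
    elim: m => [|m IHm]; first exact: combination_iter_join.
    exact: iter_join_mono.
  have [w' [v' [w'0 w'1 Xv' ->]]] := conv_hull_reduce X k w v nk w0 w1 Xv.
  exact: IH.
suff H m : iter m (segment_join X) X `<=` conv_hull X by exact: H.
elim: m => [|m IHm] z; first exact: conv_hull_sub.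
move=> [[[t x] y] [[/= + Hx] Xy] <-]; rewrite in_itv /= => t01.
apply: conv_hull_convex => //; first exact: IHm.
exact: conv_hull_sub.
Qed.

Lemma compact_segment_join X Z :
  compact X -> compact Z -> compact (segment_join X Z).
Proof.
move=> cX cZ; apply: continuous_compact; last first.
  by apply: compact_setX => //; apply: compact_setX => //; exact: segment_compact.
apply: continuous_subspaceT => t.
have fst2 : (u.1.1 @[u --> t]) --> t.1.1.
  by apply: (@cvg_comp _ _ _ fst fst); exact: cvg_fst.
apply: cvgD; apply: cvgZ => //.
- by apply: cvgB => //; exact: cvg_cst.
- by apply: (@cvg_comp _ _ _ fst snd); [exact: cvg_fst|exact: cvg_snd].
- exact: cvg_snd.
Qed.

Lemma compact_conv_hull X : compact X -> compact (conv_hull X).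
Proof.
move=> cX; rewrite conv_hull_iter_join.
suff H m : compact (iter m (segment_join X) X) by exact: H.
by elim: m => //= m; exact: compact_segment_join.
Qed.

End ConvexHull.

(** * Coordinates of column vectors *)

Lemma subvE {R : zmodType} {m} (u v : 'cV[R]_m) s : (u - v) s 0 = u s 0 - v s 0.
Proof. by rewrite !mxE. Qed.

Lemma shiftvE {R : zmodType} {m} (u : 'cV[R]_m) r s :
  (u + const_mx r) s 0 = u s 0 + r.
Proof. by rewrite !mxE. Qed.

(** * Compactness and attained bounds *)

Section Compactness.
Context {R : realType}.

Lemma continuous_functional {m n} (A : 'M[R]_(m, n)) i :
  continuous (fun x : 'cV[R]_n => (A *m x) i 0).
Proof.
have -> : (fun x : 'cV[R]_n => (A *m x) i 0) = (fun x => \sum_j A i j * x j 0).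
  by apply/funext => x; rewrite mxE.
suff H s : continuous (fun x : 'cV[R]_n => \sum_(j <- s) A i j * x j 0) by exact: H.
elim: s => [|j s IHs].
  rewrite (_ : (fun _ => _) = cst 0); first exact: cst_continuous.
  by apply/funext => x; rewrite big_nil.
rewrite (_ : (fun _ => _) =
    (fun x : 'cV[R]_n => A i j * x j 0 + \sum_(k <- s) A i k * x k 0)); last first.
  by apply/funext => x; rewrite big_cons.
move=> x; apply: (@cvgD _ _ _ _ (nbhs_filter x)); last exact: IHs.
by apply: (@cvgM _ _ _ (nbhs_filter x)); [exact: cvg_cst|exact: coord_continuous].
Qed.

Lemma closed_integer_coordinate {n} (j : 'I_n) :
  closed [set x : 'cV[R]_n | x j 0 \is a Num.int].
Proof.
have -> : [set x : 'cV[R]_n | x j 0 \is a Num.int] =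
    (fun x : 'cV[R]_n => x j 0) @^-1` [set u | u \is a Num.int] by [].
apply: preimage_closed; first by move=> x _; exact: coord_continuous.
(* the non-integers form the union of the open gaps between integers *)
have -> : [set u : R | u \is a Num.int] =
    ~` \bigcup_(k in [set: int]) `]k%:~R, (k + 1)%:~R[%classic.
  apply/seteqP; split=> [u /= ui [k _] /=|u /= H].
    rewrite in_itv /= => /andP[ku uk].
    move: ku uk; rewrite -(floorK ui) !ltr_int ltzD1 => /lt_le_trans H /H.
    by rewrite ltxx.
  apply: contrapT => /negP ui; apply: H; exists (Num.floor u) => //=.
  rewrite in_itv /= floorD1_gt andbT lt_neqAle floor_le_tmp andbT.
  by apply: contra ui => /eqP <-; exact: intr_int.
by apply: open_closedC; apply: bigcup_open => k _; exact: interval_open.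
Qed.

Lemma compact_mixed_integer {p q} (P : set 'cV[R]_(p + q)) :
  compact P -> compact (mixed_integer P).
Proof.
move=> cP.
have -> : mixed_integer P = P `&` \bigcap_(j in [set: 'I_p])
    [set x : 'cV[R]_(p + q) | x (lshift q j) 0 \is a Num.int].
  by apply/seteqP; split=> x [Px H]; split => // j; [move=> _|]; exact: H.
apply: compact_closedI => //; apply: closed_bigI => j _.
exact: closed_integer_coordinate.
Qed.

Lemma compact_minimizer {n} (K : set 'cV[R]_n) (f : 'cV[R]_n -> R) :
  continuous f -> compact K -> K !=set0 ->
  exists2 x, K x & forall y, K y -> f x <= f y.
Proof.
move=> cf cK K0.
have [x /set_mem Kx H] := compact_EVT_min K0 cK (continuous_subspaceT cf).
by exists x => // y Ky; apply: H; rewrite inE.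
Qed.

Lemma compact_inf_le {n} (K : set 'cV[R]_n) (f : 'cV[R]_n -> R) x :
  continuous f -> compact K -> K x -> inf [set f y | y in K] <= f x.
Proof.
move=> cf cK Kx; have [|m _ H] := compact_minimizer K f cf cK.
  by exists x.
apply: ge_inf; last by exists x.
by exists (f m) => _ [y Ky <-]; exact: H.
Qed.

Lemma compact_le_sup {n} (K : set 'cV[R]_n) (f : 'cV[R]_n -> R) x :
  continuous f -> compact K -> K x -> f x <= sup [set f y | y in K].
Proof.
move=> cf cK Kx; have [||m _ H] := compact_minimizer K (fun y => - f y) _ cK.
- by move=> y; apply: (@cvgN _ _ _ _ (nbhs_filter y)); exact: cf.
- by exists x.
apply: ub_le_sup; last by exists x.
by exists (f m) => _ [y Ky <-]; rewrite -lerN2; exact: H.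
Qed.

Lemma finite_le_sup {T : finType} (f : T -> R) t : f t <= sup (range f).
Proof.
apply: ub_le_sup; last by exists t.
exists (\sum_t `|f t|) => _ [u _ <-].
by rewrite (bigD1 u) //= (le_trans (ler_norm _)) // lerDl sumr_ge0.
Qed.

End Compactness.

(** * The problems of a single agent *)

Section Agents.
Context {R : realType} {S n : nat}.
Variables (X : set 'cV[R]_n) (c : 'cV[R]_n) (A : 'M[R]_(S, n)).
Hypothesis X_compact : compact X.

Lemma compact_pi_feasible y : compact (pi_feasible X A y).
Proof.
have -> : pi_feasible X A y = conv_hull X `&` \bigcap_(s in [set: 'I_S])
    ((fun z => (A *m z) s 0) @^-1` [set u | u <= y s 0]).
  by apply/seteqP; split=> x [Px H]; split => // s; [move=> _|]; exact: H.
apply: compact_closedI; first exact: compact_conv_hull.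
apply: closed_bigI => s _; apply: preimage_closed; last exact: closed_le.
by move=> x _; exact: continuous_functional.
Qed.

Lemma pi_val_le y z : pi_feasible X A y z -> pi_val X c A y <= dotv c z.
Proof.
move=> yz; apply: compact_inf_le yz; last exact: compact_pi_feasible.
by move=> x; exact: continuous_functional.
Qed.

Lemma pi_val_attained y : Ydom X A y ->
  exists2 z, pi_feasible X A y z & dotv c z = pi_val X c A y.
Proof.
move=> y0; have cd : continuous (dotv c).
  by move=> x; exact: continuous_functional.
have [z yz H] := compact_minimizer _ _ cd (compact_pi_feasible y) y0.
exists z => //; apply/le_anti; rewrite pi_val_le // andbT.
apply: lb_le_inf; first by exists (dotv c z), z.
by move=> _ [x yx <-]; exact: H.
Qed.

Lemma Lmin_le x s : X x -> Lmin X A s 0 <= (A *m x) s 0.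
Proof.
by move=> Xx; rewrite mxE; apply: (compact_inf_le X (fun x => (A *m x) s 0)) => //;
  exact: continuous_functional.
Qed.

Lemma Lmin_le_conv z s : conv_hull X z -> Lmin X A s 0 <= (A *m z) s 0.
Proof.
move=> [k [w [v [w0 w1 Xv ->]]]].
rewrite mulmx_sumr summxE -[leLHS]mul1r -w1 mulr_suml; apply: ler_sum => j _.
by rewrite -scalemxAr [leRHS]mxE ler_wpM2l // Lmin_le.
Qed.

Lemma excess_le_sup x s : X x ->
  (A *m x - Lmin X A) s 0 <= sup [set (A *m x - Lmin X A) s 0 | x in X].
Proof.
move=> Xx; apply: (compact_le_sup X (fun x' => (A *m x' - Lmin X A) s 0)) => //.
rewrite (_ : (fun _ => _) = (fun x' => (A *m x') s 0 - Lmin X A s 0)).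
  move=> x'; apply: (@cvgB _ _ _ _ (nbhs_filter x')); last exact: cvg_cst.
  exact: continuous_functional.
by apply/funext => x'; rewrite subvE.
Qed.

Variables (y : 'cV[R]_S) (rho xi : R) (x : 'cV[R]_n).
Hypothesis x_lex : lex_optimal X c A y rho xi x.

Lemma lex_rho_le x' rho' : X x' -> 0 <= rho' ->
  vle (A *m x') (y + const_mx rho') -> rho <= rho'.
Proof.
move=> Xx' r0 H; have [|/ltW//|[->]//] := x_lex.2 rho' (dotv c x') x'.
by split.
Qed.

(** [z] certifies that [rho = 0] is feasible. *)
Lemma lex_no_violation z : X z -> vle (A *m z) y -> vle (A *m x) y.
Proof.
move=> Xz zy s; have [[_ /(_ s) + _ _] _] := x_lex; rewrite shiftvE.
move=> /le_trans; apply; rewrite gerDl; apply: (lex_rho_le z) => //.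
by move=> t; rewrite shiftvE addr0.
Qed.

Hypothesis y_dom : Ydom X A y.

(** [y] dominates the resource use of a point of the convex hull, on which a
    linear form is no smaller than its minimum on [X]. *)
Lemma Lmin_le_dom s : Lmin X A s 0 <= y s 0.
Proof.
by have [z [Cz zy]] := y_dom; apply: le_trans (zy s); exact: Lmin_le_conv.
Qed.

(** Since [Lmin <= y], the amount by which the resource use of a point of [X]
    exceeds [Lmin] is a feasible [rho] for it. *)
Lemma lex_rho_le_max : (0 < S)%N -> rho <= rho_max X A.
Proof.
move=> S0; have [[_ _ Xx _] _] := x_lex.
apply: lb_le_inf; first by eexists; exists x.
move=> _ [x' Xx' <-]; set f := fun s => _.
apply: (lex_rho_le x') => //.
  apply: le_trans (finite_le_sup f (Ordinal S0)).
  by rewrite /f subvE subr_ge0 Lmin_le.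
move=> s; rewrite shiftvE; have := finite_le_sup f s.
by rewrite {1}/f subvE => H; have := Lmin_le_dom s; lra.
Qed.

(** Both terms of the minimum defining [sigma_loc] bound the excess: the first
    because [rho] does not exceed it, the second because [Lmin <= y]. *)
Lemma lex_violation_le s : (0 < S)%N ->
  (A *m x) s 0 <= y s 0 + sigma_loc X A s 0.
Proof.
move=> S0; have [[_ /(_ s) + Xx _] _] := x_lex.
rewrite shiftvE => vx; rewrite [X in _ <= _ + X]mxE addrC -lerBlDr le_min.
apply/andP; split.
  by have := lex_rho_le_max S0; lra.
apply: (@le_trans _ _ ((A *m x - Lmin X A) s 0)); last exact: excess_le_sup.
by rewrite subvE lerD2l lerN2 Lmin_le_dom.
Qed.

Lemma sigma_loc_ge0 s : (0 < S)%N -> 0 <= sigma_loc X A s 0.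
Proof.
move=> S0; have [[_ _ Xx r0] _] := x_lex.
rewrite mxE le_min (le_trans r0) ?lex_rho_le_max //=.
apply: (@le_trans _ _ ((A *m x - Lmin X A) s 0)).
  by rewrite subvE subr_ge0 Lmin_le.
exact: excess_le_sup.
Qed.
End Agents.

(** * The coupled problem *)

Section Coupled.
Context {R : realType} {N S : nat} {n : 'I_N -> nat}.
Variables (X : forall i, set 'cV[R]_(n i)) (c : forall i, 'cV[R]_(n i)).
Variables (A : forall i, 'M[R]_(S, n i)) (b sigma : 'cV[R]_S).

(** The feasible moves [z +- t * l i * d i] have mean cost that of [z]; if they
    are no cheaper then both are optimal, against uniqueness. *)
Lemma unique_LP_optimal_few_outside z :
  unique (LP_optimal X c A b sigma) z ->
  (#|[pred i | ~~ `[< X i (z i) >]]| <= S)%N.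
Proof.
move=> [[[zC zb] zmin] zuniq]; rewrite leqNgt; apply/negP => ltSI.
have dP i : {d : 'cV[R]_(n i) | [/\ ~ X i (z i) -> d != 0,
    conv_hull (X i) (z i + d) & conv_hull (X i) (z i - d)]}.
  apply: cid; have [Xz|nXz] := pselect (X i (z i)).
    by exists 0; rewrite addr0 subr0; split => //; exact: zC.
  by have [d [d0 Cp Cm]] := conv_hull_direction _ _ (zC i) nXz; exists d.
pose d i := sval (dP i).
have [l [lI [i0 li0] lE]] := dependent_family _ (fun i => A i *m d i) ltSI.
(* scaling by [t] keeps every coefficient within [[-1, 1]], where the segments
   stay in the convex hulls *)
pose t := (1 + \sum_i `|l i|)^-1.
have t0 : 0 < t by rewrite invr_gt0 ltr_wpDr // sumr_ge0.
have tl i : `|t * l i| <= 1.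
  rewrite normrM gtr0_norm // mulrC ler_pdivrMr; last by rewrite -invr_gt0.
  by rewrite mul1r (bigD1 i) //= addrCA lerDl addr_ge0 // sumr_ge0.
pose moved (e : R) i := z i + (e * (t * l i)) *: d i.
have feas e : `|e| = 1 -> LP_feasible X A b sigma (moved e).
  move=> e1; split=> [i|].
    have [_ Cp Cm] := svalP (dP i).
    by apply: conv_hull_segment => //; rewrite normrM e1 mul1r.
  rewrite /moved; under eq_bigr do rewrite mulmxDr -scalemxAr mulrA -scalerA.
  by rewrite big_split /= -scaler_sumr lE scaler0 addr0.
have cost e : \sum_i dotv (c i) (moved e i) =
    \sum_i dotv (c i) (z i) + e * \sum_i (t * l i) * dotv (c i) (d i).
  rewrite mulr_sumr -big_split /=; apply: eq_bigr => i _.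
  by rewrite /dotv /moved mulmxDr -scalemxAr mxE [X in _ + X]mxE -!mulrA.
have fp := feas 1 (normr1 _).
have fm : LP_feasible X A b sigma (moved (-1)) by apply: feas; rewrite normrN1.
have opt : LP_optimal X c A b sigma (moved 1).
  split=> // z' fz'; apply: le_trans (zmin _ fz'); have := zmin _ fm.
  by rewrite !cost; lra.
have /(congr1 (fun f => f i0)) := zuniq _ opt.
rewrite /moved mul1r => /eqP; rewrite -subr_eq0 opprD addrA subrr add0r oppr_eq0.
rewrite scaler_eq0 mulf_eq0 (negPf li0) (gt_eqF t0) /=; apply/negP.
have [d0 _ _] := svalP (dP i0); apply: d0 => Xz.
by move/negP: li0; apply; rewrite lI // inE negbK; apply/asboolP.
Qed.

Hypothesis X_compact : forall i, compact (X i).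

(** The minimizers of the subproblems cost exactly the master value, and every
    LP solution induces an allocation whose master value is at most its cost. *)
Lemma master_optimal_recovers_LP y :
  (0 < N)%N -> Master_optimal X c A b sigma y ->
  exists2 z, LP_optimal X c A b sigma z & forall i, vle (A i *m z i) (y i).
Proof.
move=> N0 [[yD yb] ymin].
have zP i : {z : 'cV[R]_(n i) | pi_feasible (X i) (A i) (y i) z /\
    dotv (c i) z = pi_val (X i) (c i) (A i) (y i)}.
  apply: cid; have [z] := pi_val_attained _ (c i) _ (X_compact i) _ (yD i).
  by exists z.
exists (fun i => sval (zP i)); last by move=> i; have [[]] := svalP (zP i).
split; first split.
- by move=> i; have [[]] := svalP (zP i).
- move=> s; rewrite -yb !summxE; apply: ler_sum => i _.
  by have [[_ /(_ s)]] := svalP (zP i).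
move=> z' [zC zb].
(* the slack of the coupling constraint is given to one agent *)
pose y' i := A i *m z' i +
  (if i == Ordinal N0 then b - sigma - \sum_i A i *m z' i else 0).
have yf i : pi_feasible (X i) (A i) (y' i) (z' i).
  split=> // s; rewrite /y' [leRHS]mxE lerDl; case: eqP => _; last by rewrite mxE.
  by rewrite subvE subr_ge0.
have fy' : Master_feasible X A b sigma y'.
  split=> [i|]; first by exists (z' i); exact: yf.
  by rewrite /y' big_split /= -big_mkcond big_pred1_eq addrC subrK.
have -> : \sum_i dotv (c i) (sval (zP i)) =
    \sum_i pi_val (X i) (c i) (A i) (y i).
  by apply: eq_bigr => i _; have [] := svalP (zP i).
apply: le_trans (ymin _ fy') _; apply: ler_sum => i _; exact: pi_val_le.
Qed.

End Coupled.

(** * Feasibility of the recovered solution *)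

Theorem mainTheorem2 (R : realType) (N S : nat) (hN : (0 < N)%N) (hS : (0 < S)%N)
  (p q : 'I_N -> nat)
  (P : forall i : 'I_N, set 'cV[R]_(p i + q i))
  (P_nonempty : forall i : 'I_N, P i !=set0)
  (P_compact : forall i : 'I_N, compact (P i))
  (P_polyhedron : forall i : 'I_N, polyhedron (P i))
  (c : forall i : 'I_N, 'cV[R]_(p i + q i))
  (A : forall i : 'I_N, 'M[R]_(S, p i + q i))
  (b : 'cV[R]_S) :
  let X := fun i : 'I_N => mixed_integer (P i) in
  let sigma := sigma_infty X A in
  (exists x : forall i : 'I_N, 'cV[R]_(p i + q i), MILP_feasible X A b x) ->
  (exists z : forall i : 'I_N, 'cV[R]_(p i + q i), LP_feasible X A b sigma z) ->
  (exists! z : forall i : 'I_N, 'cV[R]_(p i + q i), LP_optimal X c A b sigma z) ->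
  forall ystar : 'I_N -> 'cV[R]_S,
  Master_optimal X c A b sigma ystar ->
  forall (rho xi : 'I_N -> R) (x : forall i : 'I_N, 'cV[R]_(p i + q i)),
  (forall i : 'I_N, lex_optimal (X i) (c i) (A i) (ystar i) (rho i) (xi i) (x i)) ->
  (forall i : 'I_N, X i (x i)) /\ vle (\sum_(i < N) A i *m x i) b.
Proof.
move=> X sigma _ _ [z zopt] y yopt rho xi x xlex.
have X_compact i : compact (X i) by exact: compact_mixed_integer.
have yD i : Ydom (X i) (A i) (y i) by exact: yopt.1.1.
have zy i : vle (A i *m z i) (y i).
  have [z' z'opt z'y] := master_optimal_recovers_LP _ _ _ _ _ X_compact _ hN yopt.
  by rewrite (zopt.2 _ z'opt).
have few := unique_LP_optimal_few_outside _ _ _ _ _ _ zopt.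
split=> [i|s]; first by have [[]] := xlex i.
pose M := sup (range (fun i => sigma_loc (X i) (A i) s 0)).
have sM i : sigma_loc (X i) (A i) s 0 <= M.
  exact: (finite_le_sup (fun i => sigma_loc (X i) (A i) s 0)).
have M0 : 0 <= M.
  apply: le_trans (sM (Ordinal hN)).
  exact: (sigma_loc_ge0 _ _ _ _ _ _ _ _ (xlex _) (yD _)).
have viol i : (A i *m x i) s 0 <=
    y i s 0 + (if ~~ `[< X i (z i) >] then M else 0).
  case: asboolP => /= Xz.
    by rewrite addr0; exact: (lex_no_violation _ _ _ _ _ _ _ (xlex i) (z i)).
  apply: (@le_trans _ _ (y i s 0 + sigma_loc (X i) (A i) s 0)).
    exact: (lex_violation_le _ _ _ _ _ _ _ _ (xlex i)).
  by rewrite lerD2l.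
(* only the at most [S] agents with [z i] outside [X i] contribute [M] *)
rewrite summxE; apply: le_trans (ler_sum _ (fun i _ => viol i)) _.
rewrite big_split /= -summxE yopt.1.2 -big_mkcond sumr_const.
rewrite [X in X + _]mxE [X in _ + X + _]mxE [X in _ - X + _]mxE.
by rewrite -/M mulr_natl -addrA gerDl addrC subr_le0 ler_wpMn2l.
Qed.
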